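(* Let $T$ be a tree on $n$ vertices, where $n\ge 2$. Then $T$ is $\mathsf{LF}$-coverable, and one can inductively construct a maximal linear forest $F$ in $T$ and a set of vertices $S\subseteq V(F)$ such that $(F,S)$ is an $\mathsf{LF}$-cover of $T$.
   Context: All graphs are finite, simple and undirected. A linear forest is a graph every connected component of which is a path (a single vertex is a path). A linear forest in $G$ is a subgraph of $G$ that is a linear forest; it is called maximal if no other linear forest in $G$ has a greater number of edges. $\mathsf{LF}$-cover: let $F$ be a maximal linear forest in a graph $G$ and $S\subseteq V(F)$. The pair $(F,S)$ is an $\mathsf{LF}$-cover of $G$ if: (1) no vertex in $S$ is a leaf of $F$, where a leaf of $F$ means a vertex of degree at most $1$ in $F$ (so isolated vertices of $F$ count as leaves); (2) no two vertices in $S$ are adjacent in $F$; (3) for every edge $\{i,j\}\in E(G)$, either at least one of $i,j$ belongs to $S$, or both $i$ and $j$ belong to the same connected component of $F\setminus S$. $G$ is $\mathsf{LF}$-coverable if it has an $\mathsf{LF}$-cover. *)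

(* Defs.v *)
From HB Require Import structures.
From mathcomp Require Import all_boot.

Set Implicit Arguments.
Unset Strict Implicit.
Unset Printing Implicit Defensive.

(* Vertices are drawn from an ambient finite type V, so that a graph, its
   subgraphs and the results of vertex deletion all have the type sgraph V.
   Edges are 2-element sets of vertices: no loops, no multiple edges. *)
Record sgraph (V : finType) := SGraph {
  vset : {set V};
  eset : {set {set V}};
  esetP : [forall A in eset, (#|A| == 2) && (A \subset vset)] }.

Definition adj (V : finType) (G : sgraph V) : rel V :=
  fun x y => [set x; y] \in eset G.

Definition degree (V : finType) (G : sgraph V) (x : V) : nat :=
  #|[set y | adj G x y]|.

Definition subgraph (V : finType) (H G : sgraph V) : Prop :=
  vset H \subset vset G /\ eset H \subset eset G.

Lemma induced_subproof (V : finType) (G : sgraph V) (U : {set V}) :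
  [forall A in [set A in eset G | A \subset U],
     (#|A| == 2) && (A \subset vset G :&: U)].
Proof.
apply/forall_inP => A; rewrite inE => /andP[AG AU].
by have /andP[-> AV] := forall_inP (esetP G) A AG; rewrite subsetI AV AU.
Qed.

Definition induced (V : finType) (G : sgraph V) (U : {set V}) : sgraph V :=
  SGraph (induced_subproof G U).

Definition delete_vertices (V : finType) (G : sgraph V) (S : {set V}) :
  sgraph V := induced G (~: S).

Definition same_component (V : finType) (G : sgraph V) (x y : V) : bool :=
  [&& x \in vset G, y \in vset G & connect (adj G) x y].

Definition component (V : finType) (G : sgraph V) (x : V) : sgraph V :=
  induced G [set y | same_component G x y].

Definition connected_graph (V : finType) (G : sgraph V) : Prop :=
  vset G != set0 /\ {in vset G &, forall x y, same_component G x y}.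

Definition acyclic (V : finType) (G : sgraph V) : Prop :=
  forall c : seq V, 3 <= size c -> ~ ucycle (adj G) c.

Definition tree (V : finType) (G : sgraph V) : Prop :=
  connected_graph G /\ acyclic G.

(* G consists of the vertices x :: s, in this order and without repetition,
   and of exactly the edges joining consecutive ones; s = [::] gives the
   one-vertex path. *)
Definition path_graph (V : finType) (G : sgraph V) : Prop :=
  exists (x : V) (s : seq V),
    [/\ uniq (x :: s),
        vset G = [set z in x :: s] &
        eset G = [set [set a.1; a.2] | a in zip (x :: s) s]].

Definition linear_forest (V : finType) (F : sgraph V) : Prop :=
  forall x, x \in vset F -> path_graph (component F x).

Definition linear_forest_in (V : finType) (G F : sgraph V) : Prop :=
  subgraph F G /\ linear_forest F.

(* "Maximal" refers to the number of edges, not to inclusion. *)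
Definition maximal_linear_forest_in (V : finType) (G F : sgraph V) : Prop :=
  linear_forest_in G F /\
  forall F' : sgraph V, linear_forest_in G F' -> #|eset F'| <= #|eset F|.

Definition leaf (V : finType) (F : sgraph V) (x : V) : bool :=
  (x \in vset F) && (degree F x <= 1).

Record LF_cover (V : finType) (G F : sgraph V) (S : {set V}) : Prop := {
  LF_cover_maximal : maximal_linear_forest_in G F;
  LF_cover_sub : S \subset vset F;
  LF_cover_nonleaf : forall x, x \in S -> ~~ leaf F x;
  LF_cover_indep : forall x y, x \in S -> y \in S -> ~~ adj F x y;
  LF_cover_edge : forall i j, adj G i j ->
    (i \in S \/ j \in S) \/ same_component (delete_vertices F S) i j }.

Definition LF_coverable (V : finType) (G : sgraph V) : Prop :=
  exists (F : sgraph V) (S : {set V}), LF_cover G F S.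

(* Main.v *)
Require Import Defs.
From HB Require Import structures.
From mathcomp Require Import all_boot.

Set Implicit Arguments.
Unset Strict Implicit.
Unset Printing Implicit Defensive.

(** The proof rests on a certificate of optimality.  In a forest T, a linear
    forest is, up to isolated vertices, just a set E of edges in which every
    vertex has degree at most 2.  Suppose that S is a set of vertices of degree
    exactly 2 in E, that no edge of E has both ends in S, and that every edge of
    T outside E meets S ([LF_certificate]).  Then E is as large as possible: any
    linear forest E' in T has at most 2|S| edges meeting S, and its other edges
    all belong to E, whereas E has exactly 2|S| edges meeting S
    ([certificate_maximal]).  So a
    certificate yields an LF-cover ([certificate_LF_cover]); the third
    condition of a cover holds because an edge of T which avoids S is an edge
    of F that survives in F minus S.

    A certificate is built by induction on the number of edges
    ([certificate_exists]).  Either some edge has both ends of degree at most 2;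
    then a certificate for the remaining edges stays valid when this edge is
    added to E.  Or some vertex v has two pendant edges; then both go into E,
    v goes into S, and the construction continues without the edges at v.  One
    of the two cases must occur ([pendant_pair_exists]): discard all edges with
    an end of degree 1, and look at a vertex which has become a leaf.

    All of this is carried out on families of edges, since the induction only
    removes edges.  The graph-theoretic input is that an acyclic graph with an
    edge has a leaf ([acyclic_leaf]) and that an acyclic graph of maximum degree
    2 is a linear forest ([acyclic_linear_forest]); both follow by looking at a
    longest path. *)

(** * Edges, adjacency and degrees *)

Lemma card_eset (V : finType) (G : sgraph V) (A : {set V}) :
  A \in eset G -> #|A| = 2.
Proof. by move=> AG; have /andP[/eqP] := forall_inP (esetP G) A AG. Qed.

Lemma sub_eset (V : finType) (G : sgraph V) (A : {set V}) :
  A \in eset G -> A \subset vset G.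
Proof. by move=> AG; have /andP[] := forall_inP (esetP G) A AG. Qed.

Lemma adj_sym (V : finType) (G : sgraph V) : symmetric (adj G).
Proof. by move=> x y; rewrite /adj setUC. Qed.

Lemma adj_neq (V : finType) (G : sgraph V) (x y : V) : adj G x y -> x != y.
Proof. by move=> /card_eset; rewrite cards2; case: eqP. Qed.

Lemma adj_vset (V : finType) (G : sgraph V) (x y : V) :
  adj G x y -> y \in vset G.
Proof. by move=> /sub_eset/subsetP->; rewrite // !inE eqxx orbT. Qed.

Lemma connect_vset (V : finType) (G : sgraph V) (x y : V) :
  connect (adj G) x y -> x \in vset G -> y \in vset G.
Proof.
have closedG: closed (adj G) (vset G).
  apply: intro_closed => [|u v uv _]; last exact: adj_vset uv.
  exact/sym_connect_sym/adj_sym.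
by move=> xy; rewrite (closed_connect closedG xy).
Qed.

Definition incident (V : finType) (D : {set {set V}}) (v : V) : {set {set V}} :=
  [set A in D | v \in A].

Lemma incidentS (V : finType) (D E : {set {set V}}) (v : V) :
  E \subset D -> #|incident E v| <= #|incident D v|.
Proof.
move=> /subsetP ED; apply/subset_leq_card/subsetP => A.
by rewrite !inE => /andP[/ED-> ->].
Qed.

(** Degrees counted by edges rather than by neighbours make sense for any
    family of edges, which is the form used in the induction. *)
Lemma degreeE (V : finType) (G : sgraph V) (x : V) :
  degree G x = #|incident (eset G) x|.
Proof.
have inj: {in [set y | adj G x y] &, injective (fun y => [set x; y])}.
  move=> y z; rewrite !inE => xy xz /setP/(_ y); rewrite !inE eqxx orbT.
  by rewrite eq_sym (negbTE (adj_neq xy)) => /esym/eqP.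
rewrite /degree -(card_in_imset inj); apply/eq_card => A.
rewrite !inE; apply/imsetP/andP => [[y + ->]|[AG xA]].
  by rewrite !inE eqxx.
have /eqP/cards2P[u [v [_ defA]]] := card_eset AG.
move: xA AG; rewrite defA => /set2P[] <- AG; first by exists v; rewrite ?inE.
by exists u; rewrite ?inE 1?setUC // /adj setUC.
Qed.

(** Double counting of the pairs (v, A) with v in both S and A. *)
Lemma sum_incident (V : finType) (D : {set {set V}}) (S : {set V}) :
  \sum_(v in S) #|incident D v| = \sum_(A in D) #|A :&: S|.
Proof.
transitivity (\sum_(v in S) \sum_(A in D | v \in A) 1).
  apply: eq_bigr => v _; rewrite sum1_card.
  by apply: eq_card => A; rewrite !inE.
rewrite (exchange_big_dep (mem D)) /=; last by move=> v A _ /andP[].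
apply: eq_bigr => A AD; rewrite sum1_card; apply: eq_card => v.
by rewrite !inE unfold_in /= AD andbC.
Qed.

(** * Acyclic graphs and longest paths *)

Lemma acyclic_sub (V : finType) (G H : sgraph V) :
  acyclic G -> eset H \subset eset G -> acyclic H.
Proof.
move=> acG /subsetP HG c c3 /andP[cH Uc]; apply: (acG c c3).
by rewrite /ucycle Uc andbT; apply: sub_cycle cH => x y /HG.
Qed.

(** Any other neighbour of [x] on the path would close a cycle of length at
    least 3. *)
Lemma acyclic_chord (V : finType) (G : sgraph V) (x y : V) (s : seq V) :
  acyclic G -> path (adj G) x s -> uniq (x :: s) -> y \in s -> adj G x y ->
  y = head x s.
Proof.
move=> acG pxs Us /splitPr ys; case: ys pxs Us => [[|z p] q] //=.
rewrite cat_path /= => /and4P[xz zp py _] Us xy; exfalso.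
apply: (acG [:: x, z & rcons p y]) => //=; first by rewrite size_rcons.
rewrite /ucycle /= !rcons_path last_rcons xz zp py adj_sym xy /=.
have: uniq ((x :: z :: rcons p y) ++ q) by rewrite /= cat_rcons.
by rewrite cat_uniq => /andP[].
Qed.

(** Requiring every vertex of [p] to be connected to [x] keeps the path inside
    one component, so that it can be compared with that whole component. *)
Lemma longest_path (V : finType) (e : rel V) (x : V) :
  exists p : seq V,
    [/\ p != [::], sorted e p, uniq p, all (connect e x) p &
        forall q : seq V, sorted e q -> uniq q -> all (connect e x) q ->
          size q <= size p].
Proof.
pose P n := [exists t : n.-tuple V,
  [&& sorted e t, uniq t & all (connect e x) t]].
have P1: P 1 by apply/existsP; exists [tuple x]; rewrite /= connect0.
have Pmax n : P n -> n <= #|V|.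
  move=> /existsP[t /and3P[_ Ut _]].
  by rewrite -(size_tuple t) -(card_uniqP Ut) max_card.
case: (@ex_maxnP P #|V| (ex_intro _ 1 P1) Pmax) => n.
move=> /existsP[t /and3P[et Ut xt]] nmax.
exists t; split=> // [|q eq Uq xq]; last first.
  rewrite size_tuple; apply: nmax; apply/existsP; exists (in_tuple q).
  by rewrite /= eq Uq xq.
by rewrite -size_eq0 size_tuple -lt0n nmax.
Qed.

(** The first vertex of a longest path has no neighbour off the path, by
    maximality, and none on it but the second vertex, by acyclicity. *)
Lemma acyclic_leaf (V : finType) (G : sgraph V) :
  acyclic G -> eset G != set0 -> exists v, degree G v = 1.
Proof.
move=> acG /set0Pn[A AG].
have /eqP/cards2P[a [b [ab defA]]] := card_eset AG.
have adj_ab: adj G a b by rewrite /adj -defA.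
have [[|y s] [//_ es Us /= /andP[ay cs] smax]] := longest_path (adj G) a.
case: s => [|z s] in es Us cs smax *.
  have := smax [:: a; b]; rewrite /= adj_ab !inE ab connect0 connect1 //.
  by move=> /(_ isT isT isT).
exists y; apply/eqP/cards1P; exists z; apply/setP => w; rewrite !inE.
apply/idP/eqP => [yw|->]; last by case/andP: es.
have [ws|ws] := boolP (w \in z :: s).
  by rewrite (acyclic_chord acG es Us ws yw).
have := smax [:: w, y, z & s]; rewrite [sorted _ _]/= adj_sym yw => /(_ es).
move: Us => /= ->; rewrite andbT inE negb_or ws andbT eq_sym (adj_neq yw).
rewrite (connect_trans ay (connect1 yw)) ay /=.
by rewrite ltnn => /(_ isT cs).
Qed.

(** * Linear forests as acyclic graphs of maximum degree two *)

Lemma zip_index (T : eqType) (x u w : T) (s : seq T) :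
  uniq (x :: s) -> (u, w) \in zip (x :: s) s ->
  [/\ u \in x :: s, w \in x :: s & index w (x :: s) = (index u (x :: s)).+1].
Proof.
elim: s x => [|y s IHs] x //= /andP[xNs Us].
rewrite inE => /orP[/eqP[-> ->]|/(IHs _ Us)[uys wys /= iw]].
  rewrite !inE !eqxx orbT; split=> //.
  by rewrite eq_sym; move: xNs; rewrite eq_sym inE negb_or => /andP[/negbTE->].
have neq t : t \in y :: s -> (x == t) = false.
  by move=> ts; apply: contraNF xNs => /eqP->.
by rewrite ![_ \in x :: _]inE uys wys !orbT !neq // -iw.
Qed.

Lemma zip_sorted (T : eqType) (e : rel T) (x u w : T) (s : seq T) :
  path e x s -> (u, w) \in zip (x :: s) s -> e u w.
Proof.
elim: s x => [|y s IHs] x //= /andP[exy pys].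
by rewrite inE => /orP[/eqP[-> ->]|/(IHs _ pys)].
Qed.

Lemma zip_cat (T : eqType) (x u w : T) (p q s : seq T) :
  x :: s = p ++ [:: u, w & q] -> (u, w) \in zip (x :: s) s.
Proof.
elim: p x s => [|z p IHp] x s [-> ->] /=; first by rewrite inE eqxx.
case defp: (p ++ _) => [|y t]; first by case: (p) defp.
by rewrite inE (IHp y t (esym defp)) orbT.
Qed.

(** The neighbours of [v] can only be its successor and its predecessor in the
    list. *)
Lemma path_graph_degree (V : finType) (H : sgraph V) (v : V) :
  path_graph H -> degree H v <= 2.
Proof.
case=> x [s [Us _ defE]]; set p := x :: s in Us defE.
have zip_p a b : (a, b) \in zip p s ->
  [/\ a \in p, b \in p & index b p = (index a p).+1] by exact: zip_index.
clearbody p.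
pose next := nth v p (index v p).+1; pose prev := nth v p (index v p).-1.
apply: leq_trans (_ : #|[set next; prev]| <= 2); rewrite {}/next {}/prev.
  apply/subset_leq_card/subsetP => y; rewrite !inE /adj defE.
  case/imsetP=> -[a b] /zip_p[ap bp iab] /= eq_vy.
  have: v \in [set a; b] by rewrite -eq_vy !inE eqxx.
  have: y \in [set a; b] by rewrite -eq_vy !inE eqxx orbT.
  have: a \in [set v; y] by rewrite eq_vy !inE eqxx.
  have: b \in [set v; y] by rewrite eq_vy !inE eqxx orbT.
  rewrite !inE => bvy avy yab /orP[/eqP defv|/eqP defv].
    suff ->: y = b by rewrite defv -iab nth_index ?eqxx.
    case/orP: yab => /eqP// defy; move: bvy.
    by rewrite defv defy orbb => /eqP.
  suff ->: y = a by rewrite defv iab /= nth_index ?eqxx ?orbT.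
  case/orP: yab => /eqP// defy; move: avy.
  by rewrite defv defy orbb => /eqP.
by rewrite cards2; case: (_ != _).
Qed.

Lemma linear_forest_degree (V : finType) (F : sgraph V) (v : V) :
  linear_forest F -> degree F v <= 2.
Proof.
move=> linF; have [vF|vNF] := boolP (v \in vset F); last first.
  rewrite /degree; have -> : [set y | adj F v y] = set0; last by rewrite cards0.
  apply/setP => y; rewrite !inE; apply: contraNF vNF.
  by rewrite adj_sym => /adj_vset.
apply: leq_trans (path_graph_degree v (linF v vF)).
apply/subset_leq_card/subsetP => y; rewrite !inE => vy.
rewrite /adj inE -/(adj F v y) vy /=; apply/subsetP => z.
rewrite !inE /same_component vF => /orP[]/eqP->; first by rewrite vF connect0.
by rewrite (adj_vset vy) connect1.
Qed.

(** A new neighbour [w] of an end of the path would lengthen it, and a new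
    neighbour of an inner vertex would be its third. *)
Lemma longest_path_closed (V : finType) (G : sgraph V) (x u w : V) (p : seq V) :
  (forall v, degree G v <= 2) ->
  sorted (adj G) p -> uniq p -> all (connect (adj G) x) p ->
  (forall q, sorted (adj G) q -> uniq q -> all (connect (adj G) x) q ->
     size q <= size p) ->
  u \in p -> adj G u w -> w \in p.
Proof.
move=> deg2 sp Up cp pmax up uw; apply: contraT => wNp.
have cw: connect (adj G) x w := connect_trans (allP cp u up) (connect1 uw).
move: sp Up cp pmax wNp; case/splitPr: up => p1 p2 sp Up cp pmax wNp.
(* [u] is the first vertex: put [w] in front of it. *)
case/lastP: p1 => [|p1 a] in sp Up cp pmax wNp *.
  have := pmax (w :: u :: p2).
  rewrite /= -[path _ _ _]/(sorted (adj G) (u :: p2)).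
  by rewrite adj_sym uw wNp cw ltnn => /(_ sp Up cp).
(* [u] is the last vertex: append [w]. *)
case: p2 => [|b p2] in sp Up cp pmax wNp *.
  have := pmax (rcons (rcons p1 a ++ [:: u]) w).
  rewrite size_rcons ltnn rcons_uniq wNp Up all_rcons cw cp => H.
  apply: H => //; rewrite -cats1 -catA /= sorted_cat_cons /= uw andbT.
  by move: sp; rewrite sorted_cat_cons andbT.
have [au ub]: adj G a u /\ adj G u b.
  by move: sp; rewrite cat_rcons sorted_cat_cons /= => /and4P[_ -> ->].
have ab: a != b.
  move: Up; rewrite cat_uniq => /and3P[_ /hasPn/(_ b) + _].
  rewrite !inE eqxx orbT => /(_ isT); rewrite mem_rcons inE negb_or => /andP[].
  by rewrite eq_sym.
suff: 2 < degree G u by rewrite ltnNge deg2.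
apply/card_gt2P; exists a, b, w; rewrite !inE adj_sym au ub uw ab; split=> //.
move: wNp; rewrite mem_cat mem_rcons !inE !negb_or.
by move=> /andP[/andP[wa _] /and3P[_ wb _]]; rewrite eq_sym wb wa.
Qed.

(** Apply [acyclic_chord] to the part of the path that starts at the earlier of
    the two vertices. *)
Lemma acyclic_consecutive (V : finType) (G : sgraph V) (x u w : V) (s : seq V) :
  acyclic G -> path (adj G) x s -> uniq (x :: s) ->
  u \in x :: s -> w \in x :: s -> adj G u w ->
  ((u, w) \in zip (x :: s) s) || ((w, u) \in zip (x :: s) s).
Proof.
move=> acG pxs; set p := x :: s => Up.
have aux a b : a \in p -> b \in p -> adj G a b -> index a p < index b p ->
    (a, b) \in zip p s.
  move=> ap bp ab; have sp : sorted (adj G) p by [].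
  case/splitPr defp : {1}p / ap => [p1 p2].
  rewrite defp in sp Up bp *.
  have [/andP[_ Uap2] aNp1] : uniq p1 && uniq (a :: p2) /\ a \notin p1.
    move: Up; rewrite cat_uniq => /and3P[-> /hasPn/(_ a) + ->].
    by rewrite inE eqxx => /(_ isT).
  move: sp; rewrite sorted_cat_cons => /andP[_ pa].
  rewrite !index_cat (negbTE aNp1) /= eqxx addn0.
  case: ifP => [bp1|bNp1]; first by rewrite ltnNge ltnW // index_mem.
  move=> _; move: bp; rewrite mem_cat bNp1 inE eq_sym (negbTE (adj_neq ab)) /=.
  move=> bp2; have := acyclic_chord acG pa Uap2 bp2 ab.
  case: (p2) bp2 defp => [|c q] //= _ defp ->; rewrite -defp.
  exact: zip_cat defp.
move=> up wp uw; case: (ltngtP (index u p) (index w p)) => [lt|lt|eqi].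
- by rewrite aux.
- by rewrite (aux w u) ?orbT // adj_sym.
by have := adj_neq uw; rewrite -(nth_index u up) eqi nth_index ?eqxx.
Qed.

(** A longest path in the component of [x] is closed under adjacency, hence
    visits the whole component; there is no room for further edges by
    acyclicity. *)
Lemma acyclic_linear_forest (V : finType) (G : sgraph V) :
  acyclic G -> (forall v, degree G v <= 2) -> linear_forest G.
Proof.
move=> acG deg2 x xG.
have [[|y s] [//_ sp Up cp pmax]] := longest_path (adj G) x.
exists y, s; have symG := sym_connect_sym (@adj_sym V G).
have closedp: closed (adj G) (mem (y :: s)).
  apply: intro_closed => // u w uw up.
  exact: longest_path_closed sp Up cp pmax up uw.
have mem_p z : same_component G x z = (z \in y :: s).
  rewrite /same_component xG /=.
  have cxy : connect (adj G) x y by case/andP: cp.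
  apply/andP/idP => [[_ xz]|zp].
    have yz : connect (adj G) y z by rewrite (connect_trans _ xz) // symG.
    by have := closed_connect closedp yz; rewrite !inE eqxx /= => <-.
  have xz := allP cp z zp; split=> //; exact: connect_vset xz xG.
split=> //.
  apply/setP => z; rewrite [z \in vset _]inE !inE mem_p inE andb_idl // => zp.
  by have := mem_p z; rewrite inE zp => /and3P[].
apply/setP => A; rewrite inE; apply/andP/imsetP => [[AG /subsetP sA]|].
  have /eqP/cards2P[u [w [uw defA]]] := card_eset AG.
  have Ap z : z \in A -> z \in y :: s by move=> /sA; rewrite inE mem_p.
  have up: u \in y :: s by rewrite Ap // defA !inE eqxx.
  have wp: w \in y :: s by rewrite Ap // defA !inE eqxx orbT.
  have adj_uw : adj G u w by rewrite /adj -defA.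
  case/orP: (acyclic_consecutive acG sp Up up wp adj_uw) => z.
    by exists (u, w).
  by exists (w, u); rewrite //= setUC.
case=> -[u w] uw /= ->; have [up wp _] := zip_index Up uw.
split; first exact: zip_sorted sp uw.
by apply/subsetP => z; rewrite !inE mem_p => /orP[]/eqP->.
Qed.

(** * Light edges and pendant pairs *)

Definition pendant_at (V : finType) (D : {set {set V}}) (v : V) (A : {set V}) :=
  [&& A \in D, v \in A & [forall w in A, (w != v) ==> (#|incident D w| == 1)]].

(** The hereditary form of having a leaf: it characterises the edge sets of
    forests and passes to subfamilies by construction. *)
Definition forest_edges (V : finType) (D : {set {set V}}) : Prop :=
  forall E : {set {set V}}, E \subset D -> E != set0 ->
    exists v, #|incident E v| = 1.

Lemma forest_edgesS (V : finType) (D E : {set {set V}}) :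
  forest_edges D -> E \subset D -> forest_edges E.
Proof. by move=> lD ED E' E'E; apply/lD/(subset_trans E'E). Qed.

(** Let [C] consist of the edges of [D] without an end of degree 1. At a
    vertex of degree at least 2, every edge outside [C] is pendant. So it
    suffices to find [v] of degree at least 3 in [D] and at most 1 in [C]: two
    edges at [v] are then outside [C]. If [C] is empty, any vertex of degree
    at least 3 will do. Otherwise a leaf [v] of [C] lies on an edge of [C], so
    its degree in [D] is at least 2 and some edge outside [C] is pendant at
    [v]; this edge has an end of degree at least 3, which must be [v]. *)
Lemma pendant_pair_exists (V : finType) (D : {set {set V}}) :
  {in D, forall A : {set V}, #|A| = 2} -> forest_edges D -> D != set0 ->
  (forall A, ~~ ((A \in D) && [forall w in A, #|incident D w| <= 2])) ->
  exists p : V * ({set V} * {set V}),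
    [&& p.2.1 != p.2.2, pendant_at D p.1 p.2.1 & pendant_at D p.1 p.2.2].
Proof.
move=> D2 lD Dn0 heavy.
have has3 A : A \in D -> exists2 w, w \in A & 2 < #|incident D w|.
  move=> AD; have := heavy A; rewrite AD negb_forall_in.
  by case/exists_inP=> w wA; rewrite -ltnNge => w3; exists w.
pose C := [set A in D | [forall w in A, #|incident D w| != 1]].
have pendant v (A : {set V}) : v \in A -> A \in D ->
    #|incident D v| != 1 -> A \notin C -> pendant_at D v A.
  move=> vA AD v1; rewrite inE AD negb_forall_in /pendant_at AD vA.
  case/exists_inP=> w wA; rewrite negbK => w1; apply/forall_inP => u uA.
  apply/implyP => uv; suff -> : u = w by [].
  have/eqP/cards2P[a [b [_ defA]]] := D2 A AD; move: vA wA uA v1 w1 uv.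
  rewrite defA !inE => /orP[]/eqP-> /orP[]/eqP-> /orP[]/eqP-> //.
  - by move/negPf->.
  - by rewrite eqxx.
  - by rewrite eqxx.
  by move/negPf->.
suff [v v3 vC]: exists2 v, 2 < #|incident D v| & #|incident C v| <= 1.
  have : 1 < #|incident D v :\: incident C v|.
    have le := subset_leq_card (subsetIr (incident D v) (incident C v)).
    rewrite cardsD.
    by rewrite ltn_subRL (leq_ltn_trans _ v3) // addn1 ltnS (leq_trans le).
  have v1 : #|incident D v| != 1 by rewrite gtn_eqF // (ltn_trans _ v3).
  case/card_gt1P=> A [B []]; rewrite !(inE, negb_and) => /andP[AC /andP[AD vA]].
  move=> /andP[BC /andP[BD vB]] AB; exists (v, (A, B)).
  by rewrite /= AB !pendant // inE negb_and; [move: BC|move: AC];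
    rewrite (vA, vB) orbF.
have [C0|Cn0] := eqVneq C set0.
  have /set0Pn[A AD] := Dn0; have [w wA w3] := has3 A AD; exists w => //.
  rewrite C0 (_ : incident set0 w = set0) ?cards0 //.
  by apply/setP => B; rewrite !inE.
have CD : C \subset D by apply/subsetP => A; rewrite inE => /andP[].
have [v v1] := lD C CD Cn0; have /eqP/cards1P[A defA] := v1.
have: A \in incident C v by rewrite defA !inE.
rewrite 2!inE => /andP[/andP[AD /forall_inP Anl] vA].
have v2 : 1 < #|incident D v|.
  rewrite ltn_neqAle eq_sym Anl //= card_gt0; apply/set0Pn; exists A.
  by rewrite inE AD.
have : 0 < #|incident D v :\: incident C v|.
  have le := subset_leq_card (subsetIr (incident D v) (incident C v)).
  rewrite cardsD.
  by rewrite subn_gt0 (leq_ltn_trans le) // v1.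
rewrite card_gt0 => /set0Pn[B]; rewrite 2!inE => /andP[BC].
rewrite inE => /andP[BD vB]; exists v; last by rewrite v1.
have [w wB w3] := has3 B BD.
have /and3P[_ _ /forall_inP/(_ w wB)] : pendant_at D v B.
  apply: pendant => //; first exact: Anl.
  by apply: contra BC => BC; rewrite vB andbT.
have [<-//|_ /=] := eqVneq w v.
by move=> /eqP w1; rewrite w1 in w3.
Qed.

(** * Certificates *)

(** [S] plays the part of a dual solution which certifies that [E] is a
    largest subfamily of [D] with all degrees at most 2; the last three
    clauses are the complementary slackness conditions. Bounding the size of
    [A :&: S] is the form of independence that the count of the edges meeting
    [S] uses. *)
Definition LF_certificate (V : finType) (D E : {set {set V}}) (S : {set V}) :=
  [/\ E \subset D, forall v, #|incident E v| <= 2,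
      {in S, forall v, #|incident E v| = 2},
      {in E, forall A : {set V}, #|A :&: S| <= 1} &
      {in D, forall A : {set V}, A \notin E -> A :&: S != set0}].

Lemma certificate0 (V : finType) : LF_certificate set0 set0 (set0 : {set V}).
Proof.
split=> [|v|v|A|A]; rewrite ?sub0set ?inE //.
by rewrite (_ : incident _ v = set0) ?cards0 //; apply/setP => A; rewrite !inE.
Qed.

(** In [E] the ends of [A] have degree at most 1, so [A] avoids [S] and adding
    it creates no vertex of degree 3. *)
Lemma certificate_light_edge (V : finType) (D E : {set {set V}})
  (S A : {set V}) :
  A \in D -> {in A, forall w, #|incident D w| <= 2} ->
  LF_certificate (D :\ A) E S -> LF_certificate D (A |: E) S.
Proof.
move=> AD A2 [ED E2 S2 ES cov].
have AED : A |: E \subset D.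
  by rewrite subUset sub1set AD (subset_trans ED) ?subD1set.
have E_out w : w \notin A -> incident (A |: E) w = incident E w.
  move=> wA; apply/setP => B; rewrite !inE; have [->|//] := eqVneq B A.
  by rewrite (negPf wA) !andbF.
have SA w : w \in S -> w \notin A.
  move=> wS; apply/negP => wA; have := A2 w wA; rewrite leqNgt -(S2 w wS).
  move/negP; apply; apply: proper_card; apply/properP; split.
    apply/subsetP => B; rewrite !inE => /andP[BE ->].
    by have := subsetP ED B BE; rewrite !inE => /andP[_ ->].
  exists A; first by rewrite inE AD.
  rewrite inE negb_and; apply/orP; left; apply/negP => /(subsetP ED).
  by rewrite !inE eqxx.
split=> // [w|w wS|B|B BD].
- have [wA|/E_out->] := boolP (w \in A); last exact: E2.
  exact: leq_trans (incidentS w AED) (A2 w wA).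
- by rewrite E_out ?SA // S2.
- case/setU1P=> [->|/ES//]; rewrite (_ : A :&: S = set0) ?cards0 //.
  by apply/setP => w; rewrite !inE andbC; apply/negP => /andP[/SA/negP].
rewrite !inE negb_or => /andP[BA BE]; apply: cov => //.
by rewrite !inE BA.
Qed.

(** Once the edges at [v] are removed, the other ends of [A] and [B] are
    isolated; so they are not in [S], and [A] and [B] meet the new [S] in [v]
    alone. *)
Lemma certificate_pendant_pair (V : finType) (D E : {set {set V}})
  (S A B : {set V}) (v : V) :
  A != B -> pendant_at D v A -> pendant_at D v B ->
  LF_certificate (D :\: incident D v) E S ->
  LF_certificate D (A |: (B |: E)) (v |: S).
Proof.
move=> AB /and3P[AD vA /forall_inP lA] /and3P[BD vB /forall_inP lB].
move=> [ED E2 S2 ES cov]; set E' := A |: (B |: E).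
have Ev C : C \in E -> (C \in D) && (v \notin C).
  move/(subsetP ED); rewrite !inE => /andP[+ CD].
  by rewrite CD.
have EE' : E \subset E' by rewrite /E' setUA subsetUr.
have E'D : E' \subset D.
  rewrite !subUset !sub1set AD BD; apply/subsetP => C /Ev.
  by case/andP.
have v2 : #|incident E' v| = 2.
  transitivity #|[set A; B]|; last by rewrite cards2 AB.
  apply: eq_card => C; rewrite !inE.
  have [->|_] := eqVneq C A; first by rewrite vA.
  have [->|_] := eqVneq C B; first by rewrite vB.
  by apply/negP => /andP[/Ev/andP[_ /negP]].
have nonleafS w : w \in S -> #|incident D w| != 1.
  move=> wS; rewrite gtn_eqF // -(S2 w wS); apply: incidentS.
  exact: subset_trans EE' E'D.
have deg2 w : #|incident E' w| <= 2.
  have [->|wv] := eqVneq w v; first by rewrite v2.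
  have leq1 : #|incident D w| == 1 -> #|incident E' w| <= 2.
    by move=> /eqP w1; apply: leq_trans (incidentS w E'D) _; rewrite w1.
  have [wA|wA] := boolP (w \in A); first exact: leq1 (implyP (lA w wA) wv).
  have [wB|wB] := boolP (w \in B); first exact: leq1 (implyP (lB w wB) wv).
  apply: leq_trans (E2 w); apply/subset_leq_card/subsetP => C.
  rewrite !inE => /andP[+ wC]; rewrite wC andbT => /or3P[/eqP|/eqP|//] defC.
    by rewrite -defC wC in wA.
  by rewrite -defC wC in wB.
have indep (C : {set V}) :
    (forall w, w \in C -> w != v -> #|incident D w| == 1) ->
    #|C :&: (v |: S)| <= 1.
  move=> lC; rewrite -(cards1 v); apply/subset_leq_card/subsetP => w.
  rewrite !inE => /andP[wC /orP[//|wS]]; apply: contraNT (nonleafS w wS).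
  exact: lC.
split=> // [w|C|C CD].
- case/setU1P=> [->//|wS]; apply/eqP; rewrite eqn_leq deg2 -{1}(S2 w wS).
  exact: incidentS.
- case/setU1P=> [->|/setU1P[->|CE]].
  + by apply: indep => w wA; apply/implyP/lA.
  + by apply: indep => w wB; apply/implyP/lB.
  rewrite (_ : C :&: (v |: S) = C :&: S) ?ES //; apply/setP => w; rewrite !inE.
  by have [->|//] := eqVneq w v; have /andP[_ /negPf->] := Ev C CE.
rewrite !inE !negb_or => /and3P[_ _ CE]; have [vC|vC] := boolP (v \in C).
  by apply/set0Pn; exists v; rewrite !inE vC eqxx.
have /set0Pn[w] : C :&: S != set0 by apply: cov; rewrite // !inE CD vC.
by rewrite inE => /andP[wC wS]; apply/set0Pn; exists w; rewrite !inE wC wS orbT.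
Qed.

(** The case distinction is made on decidable conditions, so that the
    certificate is obtained as data. *)
Lemma certificate_exists (V : finType) (D : {set {set V}}) :
  {in D, forall A : {set V}, #|A| = 2} -> forest_edges D ->
  {ES : {set {set V}} * {set V} | LF_certificate D ES.1 ES.2}.
Proof.
have [n] := ubnP #|D|; elim: n D => // n IHn D; rewrite ltnS => Dn D2 lD.
have [->|Dn0] := eqVneq D set0.
  by exists (set0, set0); apply: certificate0.
have smaller (C : {set {set V}}) : C \proper D ->
    {ES : {set {set V}} * {set V} | LF_certificate C ES.1 ES.2}.
  move=> CD; apply: IHn; first exact: leq_trans (proper_card CD) Dn.
    by move=> A /(subsetP (proper_sub CD))/D2.
  exact: forest_edgesS lD (proper_sub CD).
pose light (A : {set V}) := (A \in D) && [forall w in A, #|incident D w| <= 2].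
case: (pickP light).
  move=> A /andP[AD /forall_inP A2].
  have [[E S] certES] := smaller _ (properD1 AD).
  by exists (A |: E, S); apply: certificate_light_edge.
move=> heavy; have /sigW[[v [A B]] /= /and3P[AB vA vB]] :
  exists p : V * ({set V} * {set V}),
    [&& p.2.1 != p.2.2, pendant_at D p.1 p.2.1 & pendant_at D p.1 p.2.2].
  by apply: pendant_pair_exists => // A; have := heavy A; rewrite /light => ->.
have [|[E S] certES] := smaller (D :\: incident D v).
  apply/properP; split; first exact: subsetDl.
  by case/and3P: vA => AD vA _; exists A; rewrite // !inE AD vA.
by exists (A |: (B |: E), v |: S); apply: certificate_pendant_pair.
Qed.

(** * From certificates to covers *)

Lemma spanning_subgraph_subproof (V : finType) (G : sgraph V)
  (E : {set {set V}}) :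
  [forall A in eset G :&: E, (#|A| == 2) && (A \subset vset G)].
Proof.
by apply/forall_inP => A /setIP[AG _]; rewrite (card_eset AG) sub_eset.
Qed.

(** Intersecting with [eset G] makes this total in [E]. *)
Definition spanning_subgraph (V : finType) (G : sgraph V) (E : {set {set V}}) :
  sgraph V := SGraph (spanning_subgraph_subproof G E).

Lemma acyclic_forest_edges (V : finType) (G : sgraph V) :
  acyclic G -> forest_edges (eset G).
Proof.
move=> acG E /setIidPr EG En0.
have [||v v1] := @acyclic_leaf V (spanning_subgraph G E).
- by apply: acyclic_sub acG _; apply: subsetIl.
- by rewrite /= EG.
by exists v; rewrite -v1 degreeE /= EG.
Qed.

(** Each edge meeting [S] is counted once on the left and once per end in [S]
    on the right. *)
Lemma card_meet (V : finType) (D : {set {set V}}) (S : {set V}) :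
  #|[set A in D | A :&: S != set0]| <= \sum_(v in S) #|incident D v|
    ?= iff [forall A in D, #|A :&: S| <= 1].
Proof.
rewrite sum_incident -sum1dep_card big_mkcondr /=.
apply: leqif_sum => A _; rewrite -card_gt0.
by case: #|A :&: S| => [|[|k]] /=; split.
Qed.

(** Both linear forests are split into the edges meeting [S] and the edges
    missing [S]. The former number at most 2|S|, with equality for [F]; the
    latter all lie in [F]. *)
Lemma certificate_maximal (V : finType) (G F : sgraph V) (S : {set V}) :
  LF_certificate (eset G) (eset F) S -> linear_forest_in G F ->
  maximal_linear_forest_in G F.
Proof.
move=> [FG _ S2 FS cov] linF; split=> // F' [[_ F'G] linF'].
pose meet (D : {set {set V}}) := [set A in D | A :&: S != set0].
pose miss (D : {set {set V}}) := [set A in D | A :&: S == set0].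
have split_card (D : {set {set V}}) : #|D| = #|meet D| + #|miss D|.
  rewrite -cardsUI (_ : meet D :&: miss D = set0) ?cards0 ?addn0.
    by apply: eq_card => A; rewrite !inE -andb_orr orNb andbT.
  by apply/setP => A; rewrite !inE andbACA andNb andbF.
rewrite (split_card (eset F')) (split_card (eset F)); apply: leq_add.
  have /eqP-> : #|meet (eset F)| == \sum_(v in S) #|incident (eset F) v|.
    by rewrite (eq_leqif (card_meet _ _)); apply/forall_inP.
  apply: leq_trans (card_meet _ _) _; apply: leq_sum => v vS.
  by rewrite S2 // -degreeE linear_forest_degree.
apply/subset_leq_card/subsetP => A; rewrite !inE => /andP[AF' AS].
rewrite AS andbT; apply: contraTT AS => AF.
by apply: cov => //; apply: (subsetP F'G).
Qed.

Lemma certificate_LF_cover (V : finType) (G : sgraph V) (E : {set {set V}})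
  (S : {set V}) :
  acyclic G -> LF_certificate (eset G) E S ->
  LF_cover G (spanning_subgraph G E) S.
Proof.
move=> acG certE; have [/setIidPr EG E2 S2 ES cov] := certE.
set F := spanning_subgraph G E.
have FE : eset F = E by rewrite /F /= EG.
have degF v : degree F v = #|incident E v| by rewrite degreeE FE.
have linF : linear_forest_in G F.
  split; first by split; rewrite //= subsetIl.
  apply: acyclic_linear_forest => [|v]; last by rewrite degF.
  by apply: acyclic_sub acG _; apply: subsetIl.
have SF : S \subset vset F.
  apply/subsetP => v /S2 v2.
  have /card_gt0P[A] : 0 < #|incident E v| by rewrite v2.
  rewrite -FE inE => /andP[/sub_eset/subsetP AF vA]; exact: AF.
split=> // [|v vS|x y xS yS|i j ij].
- by apply: (certificate_maximal (S := S)) => //; rewrite FE.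
- by rewrite /leaf degF S2 // andbF.
- apply/negP => xy; have := ES [set x; y]; rewrite -FE => /(_ xy).
  rewrite (setIidPl _) ?cards2 ?(adj_neq xy) //.
  by apply/subsetP => z /set2P[]->.
have [iS|iS] := boolP (i \in S); first by left; left.
have [jS|jS] := boolP (j \in S); first by left; right.
right; have ijF : adj (delete_vertices F S) i j.
  rewrite /adj inE FE; apply/andP; split; last first.
    by apply/subsetP => z /set2P[]->; rewrite inE.
  apply/negPn/negP => /(cov _ ij)/set0Pn[z] /setIP[/set2P[]->].
    by rewrite (negPf iS).
  by rewrite (negPf jS).
rewrite /same_component connect1 // (adj_vset ijF) andbT.
by rewrite adj_sym in ijF; rewrite (adj_vset ijF).
Qed.

Theorem theorem2p33 (V : finType) (T : sgraph V) (n : nat)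
  (treeT : tree T) (cardT : #|vset T| = n) (n_ge2 : 2 <= n) :
  (LF_coverable T *
   {FS : sgraph V * {set V} | LF_cover T FS.1 FS.2})%type.
Proof.
have acT : acyclic T by case: treeT.
have [[E S] certES] :=
  certificate_exists (@card_eset V T) (acyclic_forest_edges acT).
have coverT := certificate_LF_cover acT certES.
split; first by exists (spanning_subgraph T E), S.
by exists (spanning_subgraph T E, S).
Qed.
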